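(* Let $(X,\mu,T)$ be an ergodic measure-preserving system. Then $(X,\mu,T)$ satisfies multiple recurrence; that is, for every $k\in\mathbb{N}$ and every $f\in L^\infty(X,\mu)$ with $f>0$ one has $$\liminf_{N\to\infty}\frac1N\sum_{n=1}^N\int_X f\cdot T^nf\cdot T^{2n}f\cdots T^{kn}f\,d\mu>0.$$
   Context: A measure-preserving system is a triple $(X,\mu,\varphi)$ where $(X,\mu)$ is a probability space and $\varphi:X\to X$ is measurable, invertible with measurable inverse, and $\mu(\varphi^{-1}A)=\mu(A)$ for every measurable $A\subset X$. Its Koopman operator is $Tf:=f\circ\varphi$ (acting on $L^p(X,\mu)$, $p\in[1,\infty]$), and one writes $(X,\mu,T)$ for $(X,\mu,\varphi)$. The underlying $\sigma$-algebra is not assumed to be countably generated. The system is ergodic if every measurable $A$ with $\varphi^{-1}A\subset A$ up to a null set has measure $0$ or $1$. For $f\in L^\infty(X,\mu)$, $f>0$ means $f\ge 0$ almost everywhere and $f\neq 0$ as an element of $L^\infty(X,\mu)$. *)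

(* Defs.v *)
From HB Require Import structures.
From mathcomp Require Import all_boot all_order all_algebra.
From mathcomp Require Import all_classical all_reals all_analysis.

Set Implicit Arguments.
Unset Strict Implicit.
Unset Printing Implicit Defensive.
Import Order.TTheory GRing.Theory Num.Theory.
Import numFieldNormedType.Exports.
Local Open Scope classical_set_scope.
Local Open Scope ring_scope.

Record measure_preserving_system (d : measure_display) (X : measurableType d)
    (R : realType) (mu : probability X R) (phi : X -> X) : Prop := {
  mps_measurable : measurable_fun [set: X] phi ;
  mps_invertible : exists psi : X -> X,
    [/\ cancel phi psi, cancel psi phi & measurable_fun [set: X] psi] ;
  mps_preserving : forall A : set X, measurable A -> mu (phi @^-1` A) = mu A
}.

(* The inclusion of phi^-1(A) in A up to a null set is stated as nullity of
   the difference. *)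
Definition ergodic (d : measure_display) (X : measurableType d)
    (R : realType) (mu : probability X R) (phi : X -> X) : Prop :=
  forall A : set X, measurable A ->
    mu (phi @^-1` A `\` A) = 0%E -> mu A = 0%E \/ mu A = 1%E.

(* Elements of L^p(X, mu) are handled through representatives X -> R. *)
Definition koopman (X R : Type) (phi : X -> X) (f : X -> R) : X -> R :=
  f \o phi.

Definition ae_positive (d : measure_display) (X : measurableType d)
    (R : realType) (mu : probability X R) (f : X -> R) : Prop :=
  {ae mu, forall x, 0 <= f x} /\ ~ {ae mu, forall x, f x = 0}.

(* Main.v *)
(* Ergodicity plays no role.  The combinatorial core is the density
   Hales-Jewett theorem, proved by induction on the alphabet.  To pass from [A]
   to [option A], suppose that line-free sets have a positive limiting density
   [dl] in high dimension.  By maximality, fixing a few letters cannot change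
   the density of an almost extremal line-free set [S] much, so the theorem for
   [A] yields a positive proportion of words [z] all of whose images under
   [None |-> Some a] lie in [S].  As [S] has no line, it essentially avoids the
   set [C] of these words, hence is denser than [dl] on the complement of [C].
   That complement splits into intersections of sets insensitive to exchanging
   [None] with one letter, and such sets can be almost tiled by combinatorial
   subspaces of large dimension; on one of them [S] is line-free and too dense.

   Let [B = {f >= e}] have positive measure and let words of length [n] act
   through powers of [phi].  By the density Hales-Jewett theorem, for every [s]
   there is [j <= n] such that [B] returns along [0, js, 2js, ..., kjs] with
   probability bounded below, whence the lower bound for the averages. *)

Require Import Defs.
From HB Require Import structures.
From mathcomp Require Import all_boot all_order all_algebra.
From mathcomp Require Import all_classical all_reals all_analysis.
From mathcomp Require Import measurable_realfun ess_sup_inf.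
From mathcomp Require Import ring lra.

Import Order.TTheory GRing.Theory Num.Theory.
Import numFieldNormedType.Exports.
Local Open Scope classical_set_scope.
Local Open Scope ring_scope.

Set Implicit Arguments.
Unset Strict Implicit.
Unset Printing Implicit Defensive.

(** * Averages over finite types *)

(** On an empty type this is [0], since division by zero gives [0]; hence the witnesses [x0] where a
    nonempty type matters. *)
Definition avg (R : realType) (T : finType) (F : T -> R) : R :=
  (\sum_x F x) / #|T|%:R.

Lemma card_gt0R (R : realType) (T : finType) (x0 : T) : 0 < #|T|%:R :> R.
Proof. by rewrite ltr0n; apply/card_gt0P; exists x0. Qed.

Lemma eq_avg (R : realType) (T : finType) (F G : T -> R) :
  F =1 G -> avg F = avg G.
Proof. by move=> FG; congr (_ / _); apply: eq_bigr. Qed.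

Lemma avg_le (R : realType) (T : finType) (F G : T -> R) :
  (forall x, F x <= G x) -> avg F <= avg G.
Proof. by move=> FG; rewrite ler_wpM2r ?invr_ge0// ler_sum. Qed.

Lemma avgD (R : realType) (T : finType) (F G : T -> R) :
  avg (fun x => F x + G x) = avg F + avg G.
Proof. by rewrite /avg big_split mulrDl. Qed.

Lemma avgZ (R : realType) (T : finType) (c : R) (F : T -> R) :
  avg (fun x => c * F x) = c * avg F.
Proof. by rewrite /avg -big_distrr mulrA. Qed.

Lemma avgN (R : realType) (T : finType) (F : T -> R) :
  avg (fun x => - F x) = - avg F.
Proof. by rewrite /avg sumrN mulNr. Qed.

Lemma avgB (R : realType) (T : finType) (F G : T -> R) :
  avg (fun x => F x - G x) = avg F - avg G.
Proof. by rewrite avgD avgN. Qed.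

Lemma avg_cst (R : realType) (T : finType) (x0 : T) (c : R) :
  avg (fun _ : T => c) = c.
Proof.
rewrite /avg sumr_const -[c *+ _]mulr_natr mulfK// gt_eqF//.
exact: card_gt0R.
Qed.

Lemma avg_ge0 (R : realType) (T : finType) (F : T -> R) :
  (forall x, 0 <= F x) -> 0 <= avg F.
Proof. by move=> F0; rewrite divr_ge0// sumr_ge0. Qed.

Lemma avg_le1 (R : realType) (T : finType) (F : T -> R) :
  (forall x, F x <= 1) -> avg F <= 1.
Proof.
move=> F1; case: (pickP (@predT T)) => [x0 _|T0].
  by rewrite -[leRHS](avg_cst x0 (1 : R)) avg_le.
by rewrite /avg big_pred0// mul0r ler01.
Qed.

Lemma avg_exists_gt (R : realType) (T : finType) (x0 : T) (c : R) (F : T -> R) :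
  c < avg F -> exists x, c < F x.
Proof.
move=> cF; apply/not_existsP => nF; move: cF; apply/negP; rewrite -leNgt.
rewrite -[leRHS](avg_cst x0) avg_le// => x.
by rewrite leNgt; apply/negP.
Qed.

Lemma avg_sum (R : realType) (T U : finType) (F : T -> U -> R) :
  avg (fun x => \sum_u F x u) = \sum_u avg (F ^~ u).
Proof. by rewrite /avg exchange_big mulr_suml. Qed.

Lemma avg_exchange (R : realType) (T U : finType) (F : T -> U -> R) :
  avg (fun x => avg (F x)) = avg (fun u => avg (F ^~ u)).
Proof. by rewrite {1 3}/avg -!mulr_suml mulrAC exchange_big. Qed.

Lemma avg_pair (R : realType) (T U : finType) (F : T * U -> R) :
  avg F = avg (fun x => avg (fun u => F (x, u))).
Proof.
rewrite /avg -mulr_suml -mulrA -invfM mulrC [in RHS]mulrC card_prod natrM.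
by rewrite [X in X^-1]mulrC pair_bigA; congr (_ * _); apply: eq_bigr => -[].
Qed.

Lemma avg_bij (R : realType) (T U : finType) (h : T -> U) (F : U -> R) :
  bijective h -> avg F = avg (F \o h).
Proof.
move=> bh; rewrite /avg (bij_eq_card bh); congr (_ / _).
by rewrite (reindex h)//; apply: onW_bij.
Qed.

(** As [F <= 1], pointwise [F] is at most [c] plus the indicator of [c <= F]. *)
Lemma avg_markov (R : realType) (T : finType) (x0 : T) (c : R) (F : T -> R) :
  0 <= c -> (forall x, F x <= 1) -> 2 * c <= avg F ->
  c <= avg (fun x => (c <= F x)%R%:R).
Proof.
move=> c0 F1 cF; suff : avg F <= avg (fun x => (c <= F x)%R%:R + c).
  by rewrite avgD (avg_cst x0); lra.
apply: avg_le => x; have := F1 x.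
by case: (leP c (F x)) => h /=; rewrite ?mulr1n ?mulr0n => ?; lra.
Qed.

(** Union bound: if every label had density below [c / #|L|], the densities would add up to less
    than [c]. *)
Lemma avg_popular (R : realType) (T L : finType) (x0 : T) (c : R)
    (q : T -> bool) (Q : T -> L -> bool) :
  0 < c -> c <= avg (fun x => (q x)%:R) ->
  (forall x, q x -> exists l, Q x l) ->
  exists l, c / #|L|%:R <= avg (fun x => (Q x l)%:R).
Proof.
move=> c0 cq qQ.
have [|x] := @avg_exists_gt R T x0 0 (fun x => (q x)%:R); first lra.
case qx : (q x); rewrite ?ltxx// => _; have [l0 _] := qQ _ qx.
apply/not_existsP => nL; suff : c < c by rewrite ltxx.
apply: (le_lt_trans cq); apply: (@le_lt_trans _ _
    (avg (fun x => \sum_l (Q x l)%:R))).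
  apply: avg_le => y; case qy : (q y); last by rewrite sumr_ge0.
  have [l Ql] := qQ _ qy; rewrite (bigD1 l)//= Ql lerDl sumr_ge0//.
rewrite avg_sum; apply: (@lt_le_trans _ _ (\sum_(l : L) c / #|L|%:R)).
  apply: ltr_sum; last by move=> l _; rewrite ltNge; apply/negP/nL.
  by apply/hasP; exists l0 => //; rewrite mem_index_enum.
rewrite sumr_const -[X in X <= _]mulr_natr divfK// gt_eqF//; exact: card_gt0R.
Qed.

(** * Words, lines and combinatorial subspaces *)

Lemma expr_small (R : realType) (rho e : R) : 0 <= rho < 1 -> 0 < e ->
  exists n, forall m, (n <= m)%N -> rho ^+ m <= e.
Proof.
move=> /andP[r0 r1] e0; have r1' : `|rho| < 1 by rewrite ger0_norm.
have /cvgrPdist_le /(_ _ e0) [n _ nP] := cvg_expr r1'.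
exists n => m nm; have := nP m nm.
by rewrite /= sub0r normrN ger0_norm// exprn_ge0.
Qed.

Lemma avg_prod (R : realType) (I L : finType) (w : L -> R) :
  avg (fun x : {ffun I -> L} => \prod_i w (x i)) = avg w ^+ #|I|.
Proof.
rewrite /avg -(bigA_distr_bigA (fun (_ : I) l => w l)) prodr_const.
by rewrite card_ffun natrX expr_div_n.
Qed.

(** Exponential moments: the mean of [2^-1] to the number of letters in [G] is [avg w ^+ #|I|], and
    Markov's inequality applies. As [rho] accounts for only one letter of [G], the bound [n] is
    uniform in [G]. *)
Lemma few_good_letters (R : realType) (L : finType) (m : nat) (e : R) : 0 < e ->
  exists n, forall I : finType, (n <= #|I|)%N -> forall (G : {pred L}) (l0 : L),
    l0 \in G ->
    avg (fun x : {ffun I -> L} => (#|[pred i | x i \in G]| < m)%N%:R) <= e.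
Proof.
move=> e0; case: (pickP (@predT L)) => [l1 _|L0]; last first.
  by exists 0%N => I _ G l0; have := L0 l0.
have L1 := card_gt0R R l1.
have L2 : 1 <= #|L|%:R :> R by rewrite ler1n -(ltr0n R).
pose rho : R := 1 - (2 * #|L|%:R)^-1.
have rho01 : 0 <= rho < 1.
  rewrite /rho subr_ge0 invf_le1 ?mulr_gt0//; apply/andP; split; first lra.
  by rewrite ltrBlDr ltrDl invr_gt0 mulr_gt0.
have [n nP] := expr_small rho01 (divr_gt0 e0 (exprn_gt0 m (ltr0n R 2))).
exists n => I /nP nI G l0 l0G.
pose w l : R := if l \in G then 2^-1 else 1.
have w_rho : avg w <= rho.
  rewrite ler_pdivrMr// /rho mulrBl mul1r invfM -mulrA mulVf ?gt_eqF// mulr1.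
  have -> : #|L|%:R = \sum_(l : L) (1 : R) by rewrite sumr_const.
  rewrite (bigD1 l0)//= [in leRHS](bigD1 l0)//= /w l0G addrAC.
  have : \sum_(i | i != l0) (if i \in G then 2^-1 else 1 : R) <=
         \sum_(i | i != l0) (1 : R).
    by apply: ler_sum => i _; case: ifP => _; lra.
  lra.
have w0 : 0 <= avg w by apply: avg_ge0 => l; rewrite /w; case: ifP => _; lra.
apply: (@le_trans _ _ (avg (fun x : {ffun I -> L} => 2 ^+ m * \prod_i w (x i)))).
  apply: avg_le => x; have -> : \prod_i w (x i) = 2^-1 ^+ #|[pred i | x i \in G]|.
    rewrite (bigID [pred i | x i \in G])/= [X in _ * X]big1 ?mulr1; last first.
      by move=> i /negbTE xG; rewrite /w xG.
    by rewrite -prodr_const; apply: eq_bigr => i xG; rewrite /w xG.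
  case: ltnP => [c_m|_]; last by rewrite mulr_ge0// exprn_ge0// invr_ge0.
  rewrite exprVn ler_pdivlMr ?exprn_gt0// mul1r ler_eXn2l ?ltr1n//.
  exact: ltnW.
rewrite avgZ avg_prod -ler_pdivlMl ?exprn_gt0// mulrC (le_trans _ nI)//.
by case/andP: rho01 => r0 _; rewrite lerXn2r ?nnegrE.
Qed.

(** A line is encoded by a word over [option A] whose moving coordinates carry [None]. *)
Definition line_at (A I : finType) (L : {ffun I -> option A}) (a : A) :
  {ffun I -> A} := [ffun i => odflt a (L i)].

Definition has_line (A I : finType) (S : {ffun I -> A} -> bool) : Prop :=
  exists2 L : {ffun I -> option A},
    exists i, L i = None & forall a, S (line_at L a).

(** Coordinates with [W i = inl a] are frozen; those with [W i = inr j] form the [j]-th block,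
    nonempty when [nondeg W]. *)
Definition subsp (A I J : finType) (W : {ffun I -> A + J}) (x : {ffun J -> A}) :
  {ffun I -> A} := [ffun i => match W i with inl a => a | inr j => x j end].

Definition nondeg (A I J : finType) (W : {ffun I -> A + J}) : Prop :=
  forall j, exists i, W i = inr j.

Lemma has_line_subsp (A I J : finType) (W : {ffun I -> A + J})
    (S : {ffun I -> A} -> bool) :
  nondeg W -> has_line (S \o subsp W) -> has_line S.
Proof.
move=> Wnd [L [j Lj] LS].
exists [ffun i => match W i with inl a => Some a | inr j => L j end].
  by have [i Wi] := Wnd j; exists i; rewrite ffunE Wi.
move=> a; move: (LS a) => /=; congr (is_true (S _)); apply/ffunP => i.
by rewrite !ffunE; case: (W i) => // j'; rewrite ffunE.
Qed.

Definition comp_subsp (A I J K : finType) (W : {ffun I -> A + J})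
    (V : {ffun J -> A + K}) : {ffun I -> A + K} :=
  [ffun i => match W i with inl a => inl a | inr j => V j end].

Lemma subsp_comp (A I J K : finType) (W : {ffun I -> A + J})
    (V : {ffun J -> A + K}) x :
  subsp (comp_subsp W V) x = subsp W (subsp V x).
Proof. by apply/ffunP => i; rewrite !ffunE; case: (W i) => // j; rewrite ffunE. Qed.

Lemma nondeg_comp (A I J K : finType) (W : {ffun I -> A + J})
    (V : {ffun J -> A + K}) :
  nondeg W -> nondeg V -> nondeg (comp_subsp W V).
Proof.
move=> Wn Vn k; have [j Vj] := Vn k; have [i Wi] := Wn j.
by exists i; rewrite ffunE Wi.
Qed.

Definition merge (A I I1 I2 : finType) (e : I -> I1 + I2)
    (t : {ffun I1 -> A}) (y : {ffun I2 -> A}) : {ffun I -> A} :=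
  [ffun i => match e i with inl a => t a | inr b => y b end].

Lemma avg_merge (R : realType) (A I I1 I2 : finType) (e : I -> I1 + I2)
    (F : {ffun I -> A} -> R) : bijective e ->
  avg F = avg (fun t => avg (fun y => F (merge e t y))).
Proof.
case=> f ef fe; rewrite (@avg_bij _ _ _ (fun p => merge e p.1 p.2)) ?avg_pair//.
exists (fun x : {ffun I -> A} =>
    ([ffun a => x (f (inl a))], [ffun b => x (f (inr b))])).
  by case=> t y; congr (_, _); apply/ffunP => i; rewrite !ffunE fe.
move=> x; apply/ffunP => i; rewrite ffunE.
by rewrite -[in RHS](ef i); case: (e i) => j; rewrite ffunE.
Qed.

Definition fix_left (A I I1 I2 : finType) (e : I -> I1 + I2)
    (t : {ffun I1 -> A}) : {ffun I -> A + I2} :=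
  [ffun i => match e i with inl a => inl (t a) | inr b => inr b end].

Lemma merge_fix_left (A I I1 I2 : finType) (e : I -> I1 + I2)
    (t : {ffun I1 -> A}) y : merge e t y = subsp (fix_left e t) y.
Proof. by apply/ffunP => i; rewrite !ffunE; case: (e i). Qed.

Lemma nondeg_fix_left (A I I1 I2 : finType) (e : I -> I1 + I2)
    (t : {ffun I1 -> A}) : bijective e -> nondeg (fix_left e t).
Proof. by case=> f _ fe j; exists (f (inr j)); rewrite ffunE fe. Qed.

Definition fix_right (A I I1 I2 J : finType) (e : I -> I1 + I2)
    (W : {ffun I1 -> A + J}) (y : {ffun I2 -> A}) : {ffun I -> A + J} :=
  [ffun i => match e i with inl a => W a | inr b => inl (y b) end].

Lemma merge_fix_right (A I I1 I2 J : finType) (e : I -> I1 + I2)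
    (W : {ffun I1 -> A + J}) (y : {ffun I2 -> A}) x :
  merge e (subsp W x) y = subsp (fix_right e W y) x.
Proof.
by apply/ffunP => i; rewrite !ffunE; case: (e i) => // a; rewrite ffunE.
Qed.

Lemma nondeg_fix_right (A I I1 I2 J : finType) (e : I -> I1 + I2)
    (W : {ffun I1 -> A + J}) (y : {ffun I2 -> A}) :
  bijective e -> nondeg W -> nondeg (fix_right e W y).
Proof.
case=> f _ fe Wn j; have [i Wi] := Wn j.
by exists (f (inl i)); rewrite ffunE fe.
Qed.

Lemma split_pred (I : finType) (P : pred I) :
  exists (I1 I2 : finType) (e : I -> I1 + I2),
    [/\ bijective e, #|I1| = #|P|, #|I2| = (#|I| - #|P|)%N &
        forall i, P i = (if e i is inl _ then true else false)].
Proof.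
pose e i : {i | P i} + {i | ~~ P i} :=
  match Sumbool.sumbool_of_bool (P i) with
  | left h => inl (exist _ i h) | right h => inr (exist _ i (negbT h)) end.
exists {i | P i}, {i | ~~ P i}, e; split.
- exists (fun s => match s with inl u => val u | inr u => val u end).
    by move=> i; rewrite /e; case: Sumbool.sumbool_of_bool.
  case=> -[i Pi]; rewrite /e/=; case: Sumbool.sumbool_of_bool => h.
  + by congr inl; apply: val_inj.
  + by exfalso; rewrite Pi in h.
  + by exfalso; rewrite h in Pi.
  + by congr inr; apply: val_inj.
- by rewrite card_sig.
- by rewrite card_sig -[#|I|](cardC P) addKn.
- by move=> i; rewrite /e; case: Sumbool.sumbool_of_bool => ->.
Qed.

Lemma split_card (I : finType) (m : nat) : (m <= #|I|)%N ->
  exists (I1 I2 : finType) (e : I -> I1 + I2),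
    [/\ bijective e, #|I1| = m & #|I2| = (#|I| - m)%N].
Proof.
move=> mI; have [I1 [I2 [e [be c1 c2 _]]]] :=
  split_pred [pred i : I | (enum_rank i < m)%N].
suff cP : #|[pred i : I | (enum_rank i < m)%N]| = m.
  by exists I1, I2, e; split; rewrite // ?c1 ?c2 cP.
have wI : injective (widen_ord mI).
  by move=> a b /(congr1 (@nat_of_ord _)) /= /ord_inj.
rewrite -[RHS]card_ord -(card_codom (inj_comp enum_val_inj wI)).
apply: eq_card => i; rewrite !inE; apply/idP/codomP => [im|[j ->]].
  exists (Ordinal im) => /=; rewrite -[LHS]enum_rankK; congr enum_val.
  exact: val_inj.
by rewrite /= enum_valK /= ltn_ord.
Qed.

Definition resample (I L B : finType) (g : B -> L) (x : {ffun I -> L})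
    (y : {ffun I -> B}) : {ffun I -> L} :=
  [ffun i => if x i \in codom g then g (y i) else x i].

(* Swapping the letter [x i = g b] with [g (y i)], and [y i] with [b], is an
   involution of the pairs [(x, y)]. *)
Lemma avg_resample (R : realType) (I L B : finType) (b0 : B) (g : B -> L)
    (F : {ffun I -> L} -> R) : injective g ->
  avg (fun x => avg (fun y => F (resample g x y))) = avg F.
Proof.
move=> gI; rewrite -(avg_pair (fun p => F (resample g p.1 p.2))).
transitivity (avg (fun p : {ffun I -> L} * {ffun I -> B} => F p.1)); last first.
  by rewrite avg_pair; apply: eq_avg => x /=; rewrite (avg_cst [ffun=> b0]).
pose s (p : {ffun I -> L} * {ffun I -> B}) :=
  (resample g p.1 p.2, [ffun i => odflt (p.2 i) [pick b | g b == p.1 i]]).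
rewrite [RHS](@avg_bij _ _ _ s)//; suff sK : cancel s s by exists s.
case=> x y; rewrite /s/=; congr (_, _); apply/ffunP => i; rewrite !ffunE.
  case: (boolP (x i \in codom g)) => [/codomP[b ->]|/negbTE nx]; last by rewrite !nx.
  by rewrite !codom_f; case: pickP => [b' /eqP/gI ->|/(_ b)]//=; rewrite eqxx.
case: (boolP (x i \in codom g)) => [/codomP[b ->]|nx].
  rewrite ?codom_f.
  case: (pickP (fun b' => g b' == g (y i))) => [b' /eqP/gI ->|/(_ (y i))]//=.
  by rewrite eqxx.
by case: pickP => [b' /eqP xb|//]; rewrite -xb codom_f in nx.
Qed.

(* Conditioning a random word on everything but the values of those of its
   letters that lie in the image of [g] gives a random subspace, of large
   dimension with high probability. *)
Lemma fiber_subsp (R : realType) (L : finType) (m : nat) (e : R) : 0 < e ->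
  exists n, forall I : finType, (n <= #|I|)%N ->
    forall (B : finType) (b0 : B) (g : B -> L) (F : {ffun I -> L} -> R),
    injective g -> (forall x, F x <= 1) -> e < avg F ->
    exists (J : finType) (W : {ffun I -> L + J}),
      [/\ nondeg W, (m <= #|J|)%N &
        0 < avg (fun y : {ffun J -> B} => F (subsp W [ffun j => g (y j)]))].
Proof.
move=> e0; have [n nP] := few_good_letters L m e0.
exists n => I /nP nI B b0 g F gI F1 eF.
have := nI [pred l | l \in codom g] (g b0); rewrite inE codom_f => /(_ isT) bad.
(* Subtracting the indicator of the words with fewer than [m] letters in the image of [g] keeps the
   average positive and, as [F <= 1], rules these words out. *)
have [|x] := @avg_exists_gt R _ [ffun=> g b0] 0 (fun x => avg (fun y =>
    F (resample g x y)) -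
    (#|[pred i | x i \in [pred l | l \in codom g]]| < m)%N%:R).
  by rewrite avgB (avg_resample b0)// subr_gt0 (le_lt_trans bad).
rewrite subr_gt0; case: ltnP => [_|mx]; rewrite ?mulr0n ?mulr1n.
  by rewrite ltNge avg_le1.
have [J [K [f [bf cJ _ fP]]]] := split_pred [pred i | x i \in codom g].
(* Only the values of [y] on [J] enter [resample g x y]; the others are frozen at [z]. *)
rewrite (avg_merge _ bf) avg_exchange => /(avg_exists_gt [ffun=> b0])[z z0].
exists J, [ffun i => match f i with inl j => inr j | inr _ => inl (x i) end].
split; last 2 first.
- by rewrite cJ.
- congr (0 < _): z0; apply: eq_avg => y; congr F; apply/ffunP => i.
  by have := fP i; rewrite !ffunE /= => ->; case: (f i) => j; rewrite ?ffunE.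
by case: bf => h _ fh j; exists (h (inl j)); rewrite ffunE fh.
Qed.

Definition density_hales_jewett (R : realType) (A : finType) : Prop :=
  forall c : R, 0 < c -> exists n, forall I : finType, (n <= #|I|)%N ->
    forall S : {ffun I -> A} -> bool,
    c <= avg (fun x => (S x)%:R) -> has_line S.

(** Induction on [d]. Slicing along [m] coordinates, many suffixes [y] have a dense slice, which
    contains a line; a popular line [L] serves a proportion [c'] of all suffixes. The induction
    hypothesis applies to these suffixes, and [L] supplies the new direction [ord0]. *)
Lemma multidim_density_hales_jewett (R : realType) (A : finType) (a0 : A) :
  density_hales_jewett R A -> forall (d : nat) (c : R), 0 < c ->
  exists n, forall I : finType, (n <= #|I|)%N ->
    forall S : {ffun I -> A} -> bool, c <= avg (fun x => (S x)%:R) ->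
    exists2 W : {ffun I -> A + 'I_d}, nondeg W & forall x, S (subsp W x).
Proof.
move=> dhj; elim=> [|d IHd] c c0.
  exists 0%N => I _ S cS; have [|x] := @avg_exists_gt R _ [ffun=> a0] 0
    (fun x => (S x)%:R); first exact: lt_le_trans cS.
  case Sx : (S x); rewrite ?ltxx// => _; exists [ffun i => inl (x i)].
    by case.
  by move=> y; rewrite (_ : subsp _ y = x)//; apply/ffunP => i; rewrite !ffunE.
have c2 : 0 < c / 2 by rewrite divr_gt0.
have [m mP] := dhj _ c2.
pose c' : R := c / 2 / (#|A|.+1 ^ m)%:R.
have [|n nP] := IHd c'; first by rewrite divr_gt0// ltr0n expn_gt0.
exists (m + n)%N => I mnI S cS.
have [I1 [I2 [e [be c1 c2']]]] := split_card (leq_trans (leq_addr n m) mnI).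
have nI2 : (n <= #|I2|)%N by rewrite c2' leq_subRL// (leq_trans _ mnI)// leq_addr.
pose F y : R := avg (fun t => (S (merge e t y))%:R).
pose Q y (L : {ffun I1 -> option A}) :=
  [exists i, L i == None] && [forall a, S (merge e (line_at L a) y)].
have [L] : exists L, c / 2 / #|{ffun I1 -> option A}|%:R <=
    avg (fun y => (Q y L)%:R).
  apply: (@avg_popular _ _ _ [ffun=> a0] _ (fun y => c / 2 <= F y)) => //.
    apply: avg_markov; [exact: [ffun=> a0]|exact: ltW| |].
      by move=> y; apply: avg_le1 => t; case: (S _).
    by rewrite mulrC divfK// /F avg_exchange -(avg_merge (fun x => (S x)%:R) be).
  move=> y /(mP I1); rewrite c1 => /(_ (leqnn _))[L [i Li] LS].
  exists L; apply/andP; split; first by apply/existsP; exists i; rewrite Li.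
  exact/forallP.
rewrite card_ffun card_option c1 => /nP -/(_ nI2)[W Wn WQ].
have /andP[/existsP[i0 /eqP Li0] _] := WQ [ffun=> a0].
case: (be) => f ef fe.
exists [ffun i => match e i with
  | inl i1 => if L i1 is Some a then inl a else inr ord0
  | inr i2 => match W i2 with inl a => inl a | inr j => inr (lift ord0 j) end
  end].
  move=> j; case: (unliftP ord0 j) => [k ->|->].
    by have [i Wi] := Wn k; exists (f (inr i)); rewrite ffunE fe Wi.
  by exists (f (inl i0)); rewrite ffunE fe Li0.
move=> x; have /andP[_ /forallP/(_ (x ord0))] := WQ [ffun j => x (lift ord0 j)].
congr (is_true (S _)); apply/ffunP => i; rewrite !ffunE.
case: (e i) => j; rewrite ffunE; first by case: (L j).
by case: (W j) => // k; rewrite ffunE.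
Qed.

(** * Insensitive sets *)

Definition to_letter (A I : finType) (a : A) (x : {ffun I -> option A}) :
  {ffun I -> option A} := [ffun i => Some (odflt a (x i))].

(** Words that differ only by exchanges of [None] and [Some a] have the same image under
    [to_letter a], so this equation gives invariance under all such exchanges. *)
Definition insensitive (A I : finType) (a : A)
    (D : {ffun I -> option A} -> bool) : Prop :=
  forall x, D (to_letter a x) = D x.

Lemma insensitive_subsp (A I J : finType) (a : A)
    (D : {ffun I -> option A} -> bool) (W : {ffun I -> option A + J}) :
  insensitive a D -> insensitive a (D \o subsp W).
Proof.
move=> Da x /=; rewrite -Da -[RHS]Da; congr D; apply/ffunP => i.
by rewrite !ffunE; case: (W i) => // j; rewrite ffunE.
Qed.

(** By [fiber_subsp] with [g = Some], [D] is dense among the words without [None] in some subspace,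
    so the theorem for [A] applies there. Insensitivity then lets the free coordinates take the
    value [None] too. *)
Lemma dense_insensitive_subsp (R : realType) (A : finType) (a0 : A) (d : nat)
    (c : R) : density_hales_jewett R A -> 0 < c ->
  exists n, forall I : finType, (n <= #|I|)%N ->
    forall (a : A) (D : {ffun I -> option A} -> bool), insensitive a D ->
    c <= avg (fun x => (D x)%:R) ->
    exists2 W : {ffun I -> option A + 'I_d}, nondeg W & forall x, D (subsp W x).
Proof.
move=> dhj c0; have [c2 c4] : 0 < c / 2 /\ 0 < c / 4 by split; lra.
have [m mP] := multidim_density_hales_jewett a0 dhj d c2.
have [n nP] := @fiber_subsp R (option A) m _ c4.
exists n => I /nP nI a D Da cD.
have [||J [W [Wn mJ]]] := nI A a0 Some (fun x => (D x)%:R - c / 2) Some_inj.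
- by move=> x; case: (D x) => /=; lra.
- by rewrite avgB (avg_cst [ffun=> None]); lra.
rewrite avgB (avg_cst [ffun=> a0]) subr_gt0 => /ltW/(mP J mJ)[V Vn VD].
pose V' := [ffun j => match V j with inl b => inl (Some b) | inr k => inr k end].
exists (comp_subsp W V').
  by apply: nondeg_comp => // k; have [j Vj] := Vn k; exists j; rewrite ffunE Vj.
move=> x; have := VD [ffun k => odflt a (x k)]; rewrite -Da -[X in _ -> is_true X]Da.
congr (is_true (D _)); apply/ffunP => i; rewrite !ffunE.
by case: (W i) => // j; rewrite !ffunE; case: (V j) => // k; rewrite ffunE.
Qed.

Lemma subsp_inj (A I J : finType) (W : {ffun I -> A + J}) :
  nondeg W -> injective (subsp W).
Proof.
move=> Wn x y /ffunP xy; apply/ffunP => j; have [i Wi] := Wn j.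
by have := xy i; rewrite !ffunE Wi.
Qed.

(* A dense insensitive [D] contains many parallel copies, inside the first
   coordinates, of one subspace [W].  Either one of them works, or their removal
   costs [f] nothing and divides the density of [D] by at least [(1 - h)^-1];
   the slices of what is left over the first coordinates are still insensitive. *)
Lemma insensitive_iter (R : realType) (A : finType) (a0 : A) (d : nat) (e : R) :
  density_hales_jewett R A -> 0 < e <= 1 ->
  exists (m : nat) (h : R), 0 < h <= 1 /\
    forall (r : nat) (I : finType), (r * m <= #|I|)%N ->
    forall (a : A) (D : {ffun I -> option A} -> bool)
      (f : {ffun I -> option A} -> R),
    insensitive a D -> (forall x, f x <= 1) ->
    e + (1 - h) ^+ r * avg (fun x => (D x)%:R) < avg (fun x => f x * (D x)%:R) ->
    exists2 W : {ffun I -> option A + 'I_d}, nondeg W &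
      0 < avg (fun x => f (subsp W x)).
Proof.
move=> dhj /andP[e0 e1]; have e2 : 0 < e / 2 by lra.
have [m mP] := dense_insensitive_subsp a0 d dhj e2.
(* [c] is the proportion of suffixes served by a popular subspace template on [m] coordinates. Each
   of them loses at least one of its [#|A|.+1 ^ m] prefixes, whence [h]. *)
pose c : R := e / 2 / ((#|A|.+1 + d) ^ m)%:R.
pose h : R := c / (#|A|.+1 ^ m)%:R.
have le_div (u : R) k : 0 <= u -> (0 < k)%N -> 0 <= u / k%:R <= u.
  move=> u0 k0; rewrite divr_ge0//= ler_pdivrMr ?ltr0n// ler_peMr//.
  by rewrite ler1n.
have c01 : 0 < c <= 1.
  rewrite divr_gt0//= ?ltr0n ?expn_gt0//.
  have /andP[_] := le_div _ ((#|A|.+1 + d) ^ m)%N (ltW e2) (expn_gt0 _ _ : _ = _).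
  by rewrite -/c; lra.
have h01 : 0 < h <= 1.
  rewrite divr_gt0//= ?ltr0n ?expn_gt0//; last by case/andP: c01.
  case/andP: c01 => c0 c1.
  have /andP[_] := le_div _ (#|A|.+1 ^ m)%N (ltW c0) (expn_gt0 _ _ : _ = _).
  by rewrite -/h; lra.
exists m, h; split => //; elim=> [|r IHr] I rmI a D f Da f1 lt_fD.
  exfalso; move: lt_fD; apply/negP; rewrite -leNgt expr0 mul1r.
  rewrite (@le_trans _ _ (avg (fun x => (D x)%:R)))//; last by rewrite lerDr ltW.
  by apply: avg_le => x; rewrite ler_piMl.
have h0 : 0 <= 1 - h by lra.
have D0 : 0 <= avg (fun x => (D x)%:R) :> R by exact: avg_ge0.
have D1 : avg (fun x => (D x)%:R) <= 1 :> R.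
  by apply: avg_le1 => x; case: (D x).
have fD : avg (fun x => f x * (D x)%:R) <= avg (fun x => (D x)%:R).
  by apply: avg_le => x; rewrite ler_piMl.
have eD : e <= avg (fun x => (D x)%:R).
  rewrite (le_trans _ fD)// ltW// (le_lt_trans _ lt_fD)// lerDl mulr_ge0//.
  exact: exprn_ge0.
have mI : (m <= #|I|)%N by rewrite (leq_trans _ rmI)// mulSn leq_addr.
have [I1 [I2 [s [bs c1 c2]]]] := split_card mI.
have rI2 : (r * m <= #|I2|)%N by rewrite c2 leq_subRL// -mulSn.
pose Q y (W : {ffun I1 -> option A + 'I_d}) :=
  [forall j, exists i, W i == inr j] && [forall x, D (merge s (subsp W x) y)].
have ins_l t : insensitive a (fun y => D (merge s t y)).
  move=> y; rewrite -Da -[RHS]Da; congr D; apply/ffunP => i.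
  by rewrite !ffunE; case: (s i) => // j; rewrite ffunE.
have ins_r y : insensitive a (fun t => D (merge s t y)).
  move=> t; rewrite -Da -[RHS]Da; congr D; apply/ffunP => i.
  by rewrite !ffunE; case: (s i) => // j; rewrite ffunE.
have [W] : exists W, e / 2 / #|{ffun I1 -> option A + 'I_d}|%:R <=
    avg (fun y => (Q y W)%:R).
  pose F y : R := avg (fun t => (D (merge s t y))%:R).
  apply: (@avg_popular _ _ _ [ffun=> None] _ (fun y => e / 2 <= F y)) => //.
    apply: avg_markov; [exact: [ffun=> None]|exact: ltW| |].
      by move=> y; apply: avg_le1 => t; case: (D _).
    by rewrite mulrC divfK// /F avg_exchange -(avg_merge (fun x => (D x)%:R) bs).
  move=> y /(mP I1 _ a _ (ins_r y)); rewrite c1 => /(_ (leqnn _))[W Wn WD].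
  exists W; apply/andP; split; last exact/forallP.
  by apply/forallP => j; apply/existsP; have [i Wi] := Wn j; exists i; rewrite Wi.
rewrite card_ffun card_sum card_option card_ord c1 -/c => cQ.
have [|y] := @avg_exists_gt R _ [ffun=> None] 0 (fun y => (Q y W)%:R); first lra.
case Qy : (Q y W); rewrite ?ltxx// => _; case/andP: Qy => /forallP Wn _ {y}.
have {}Wn : nondeg W by move=> j; have /existsP[i /eqP] := Wn j; exists i.
case: (pselect (exists2 y, Q y W & 0 < avg (fun x => f (merge s (subsp W x) y)))).
  case=> y _ y0; exists (fix_right s W y); first exact: nondeg_fix_right.
  by congr (0 < _): y0; apply: eq_avg => x; rewrite merge_fix_right.
move=> noy; pose im t := [exists x, subsp W x == t].
(* What is left of [D] after removal of the copies of [W]. By [noy], [f] has average at most [0] on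
   each copy, which gives [fE]. *)
pose E t y := D (merge s t y) && ~~ (im t && Q y W).
have imQD t y : im t -> Q y W -> D (merge s t y).
  by case/existsP => x /eqP <- /andP[_ /forallP].
have sum_im (F : {ffun I1 -> option A} -> R) :
    \sum_t F t * (im t)%:R = \sum_x F (subsp W x).
  rewrite (bigID im)/= [X in _ + X]big1 ?addr0; last first.
    by move=> t /negbTE ->; rewrite mulr0.
  rewrite -(big_imset _ (h := subsp W) (A := predT))/=; last first.
    by move=> x y _ _; apply: subsp_inj.
  apply: eq_big => [t|t ->]; last by rewrite mulr1.
  apply/existsP/imsetP => [[x /eqP <-]|[x _ ->]]; first by exists x.
  by exists x.
have fE : avg (fun x => f x * (D x)%:R) <=
    avg (fun t => avg (fun y => f (merge s t y) * (E t y)%:R)).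
  rewrite (avg_merge _ bs) -subr_le0 -avgB.
  rewrite (@eq_avg _ _ _ (fun t => avg (fun y =>
      (Q y W)%:R * (f (merge s t y) * (im t)%:R)))); last first.
    move=> t; rewrite -avgB; apply: eq_avg => y; rewrite /E.
    case imt : (im t); case Qy : (Q y W); rewrite /= ?andbT ?andbF /=;
      rewrite ?mulr0n ?mulr1n; try ring.
    by rewrite imQD// ?mulr0n ?mulr1n; ring.
  rewrite avg_exchange -oppr_ge0 -avgN; apply: avg_ge0 => y; rewrite avgZ.
  case Qy : (Q y W); last by rewrite mul0r oppr0.
  rewrite mul1r /avg (sum_im (fun t => f (merge s t y))) -mulNr divr_ge0//.
  rewrite oppr_ge0 leNgt; apply/negP => sum0; apply: noy; exists y => //.
  by rewrite divr_gt0// (card_gt0R _ [ffun=> None]).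
have hE : avg (fun t => avg (fun y => (E t y)%:R)) <=
    (1 - h) * avg (fun x => (D x)%:R) :> R.
  suff : h <= avg (fun x => (D x)%:R) - avg (fun t => avg (fun y => (E t y)%:R)).
    suff : h * avg (fun x => (D x)%:R) <= h by lra.
    by rewrite ler_piMr//; lra.
  rewrite (avg_merge _ bs) -avgB.
  rewrite (@eq_avg _ _ _ (fun t => avg (fun y => (Q y W)%:R) * (im t)%:R));
      last first.
    move=> t; rewrite -avgB mulrC -avgZ; apply: eq_avg => y; rewrite /E.
    case imt : (im t); case Qy : (Q y W); rewrite /= ?andbT ?andbF /=;
      rewrite ?mulr0n ?mulr1n; try ring.
    by rewrite imQD// ?mulr0n ?mulr1n; ring.
  rewrite avgZ /h ler_pM//; first lra.
  rewrite /avg card_ffun card_option c1 ler_peMl ?invr_ge0//.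
  have := sum_im (fun=> 1); rewrite (eq_bigr (fun t => (im t)%:R)); last first.
    by move=> t _; rewrite mul1r.
  by move=> ->; rewrite sumr_const ler1n; apply/card_gt0P; exists [ffun=> None].
(* Averaging over prefixes yields a slice that satisfies the hypothesis for [r]. *)
have [|t] := @avg_exists_gt R _ [ffun=> None] 0 (fun t =>
    avg (fun y => f (merge s t y) * (E t y)%:R) -
    (e + (1 - h) ^+ r * avg (fun y => (E t y)%:R))).
  rewrite avgB avgD (avg_cst [ffun=> None]) avgZ subr_gt0.
  rewrite (lt_le_trans _ fE)// (le_lt_trans _ lt_fD)// lerD2l exprSr -mulrA.
  by rewrite ler_wpM2l// exprn_ge0.
rewrite subr_gt0 => /(IHr I2 rI2 a (E t) (fun y => f (merge s t y))).
case=> // [y|V Vn V0].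
  rewrite /E ins_l /Q; congr (_ && ~~ (_ && (_ && _))).
  by apply: eq_forallb => x; rewrite ins_l.
exists (comp_subsp (fix_left s t) V).
  by apply: nondeg_comp => //; apply: nondeg_fix_left.
by congr (0 < _): V0; apply: eq_avg => x; rewrite subsp_comp merge_fix_left.
Qed.

(** [single] treats one set, iterating until [(1 - h) ^+ q] is small. Applied to the first set with
    a large dimension [m], it leaves the other sets, still insensitive on the subspace [W], to the
    induction hypothesis. *)
Lemma insensitive_inter (R : realType) (A : finType) (a0 : A) (r : seq A)
    (d : nat) (e : R) : density_hales_jewett R A -> 0 < e ->
  exists n, forall I : finType, (n <= #|I|)%N ->
    forall (D : A -> {ffun I -> option A} -> bool)
      (f : {ffun I -> option A} -> R),
    (forall a, insensitive a (D a)) -> (forall x, f x <= 1) ->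
    e < avg (fun x => f x * (all (D^~ x) r)%:R) ->
    exists2 W : {ffun I -> option A + 'I_d}, nondeg W &
      0 < avg (fun x => f (subsp W x)).
Proof.
move=> dhj; have single d' e' : 0 < e' -> exists n, forall I : finType,
    (n <= #|I|)%N -> forall a (D : {ffun I -> option A} -> bool)
      (f : {ffun I -> option A} -> R),
    insensitive a D -> (forall x, f x <= 1) ->
    e' < avg (fun x => f x * (D x)%:R) ->
    exists2 W : {ffun I -> option A + 'I_d'}, nondeg W &
      0 < avg (fun x => f (subsp W x)).
  move=> e'0; have e20 : 0 < Num.min (e' / 2) 1 <= 1.
    by rewrite lt_min ltr01 divr_gt0//= ge_min lexx orbT.
  have [m [h [/andP[h0 h1] mP]]] := insensitive_iter a0 d' dhj e20.
  have hr : 0 <= 1 - h < 1 by apply/andP; split; lra.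
  have [q /(_ q (leqnn q)) qP] := expr_small hr (divr_gt0 e'0 (ltr0n R 2)).
  exists (q * m)%N => I /mP IP a D f Da f1 fD.
  apply: (IP a D f Da f1); apply: le_lt_trans fD.
  rewrite [leRHS]splitr lerD// ?ge_min ?lexx//.
  rewrite (le_trans _ qP)// ler_piMr// ?exprn_ge0//; first by case/andP: hr.
  by apply: avg_le1 => x; case: (D x).
elim: r d e => [|a r IHr] d e e0.
  have [n nP] := single d _ e0; exists n => I /nP IP D f _ f1 fe.
  by apply: (IP a0 predT f) => // x.
have e2 : 0 < e / 2 by lra.
have [m mP] := IHr d _ e2; have [n nP] := single m _ e2.
exists n => I /nP IP D f DI f1 fe.
(* The shift by [e / 2] costs at most [e / 2] on [D a], and turns a positive average on [W] into the
   bound that the induction hypothesis requires. *)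
have [x||W Wn] := IP a (D a) (fun x => f x * (all (D^~ x) r)%:R - e / 2) (DI a).
- by have := f1 x; case: (all _ _); rewrite ?mulr1 ?mulr0; lra.
- rewrite (@eq_avg _ _ _ (fun x => f x * (all (D^~ x) (a :: r))%:R -
      e / 2 * (D a x)%:R)); last first.
    by move=> x /=; case: (D a x); case: (all _ _) => /=; ring.
  rewrite avgB avgZ; have : avg (fun x => (D a x)%:R) <= 1 :> R.
    by apply: avg_le1 => x; case: (D a x).
  by rewrite -(ler_pM2l e2) mulr1; lra.
rewrite avgB (avg_cst [ffun=> None]) subr_gt0.
case/(mP _ _ (fun b => D b \o subsp W) (fun x => f (subsp W x))).
- by rewrite card_ord.
- by move=> b; apply: insensitive_subsp.
- by move=> x.
move=> V Vn V0; exists (comp_subsp W V); first exact: nondeg_comp.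
by congr (0 < _): V0; apply: eq_avg => x; rewrite subsp_comp.
Qed.

(** The deficits [u - F y] are nonnegative and add up to the right-hand side. Thus an average close
    to the maximum forces every value to be close to it. *)
Lemma avg_deficit (R : realType) (T : finType) (u : R) (F : T -> R) (x : T) :
  (forall y, F y <= u) -> u - F x <= #|T|%:R * (u - avg F).
Proof.
move=> Fu; have T0 := card_gt0R R x.
have -> : u - avg F = avg (fun y => u - F y) by rewrite avgB (avg_cst x).
rewrite /avg mulrC divfK ?gt_eqF// (bigD1 x)//= lerDl sumr_ge0// => y _.
by rewrite subr_ge0.
Qed.

(** * The density Hales-Jewett theorem *)

Definition line_free_bound (R : realType) (A : finType) (n : nat) (c : R) : Prop :=
  forall I : finType, (n <= #|I|)%N -> forall S : {ffun I -> A} -> bool,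
    ~ has_line S -> avg (fun x => (S x)%:R) <= c.

(** The last two hypotheses make [dl] the limiting density of line-free sets: no such set is much
    denser in high dimension, and almost extremal ones exist in arbitrarily high dimension. The
    contradiction is a subspace on which a line-free set has density above [dl + mu]. *)
Lemma limit_density_absurd (R : realType) (A : finType) (a0 : A) (dl : R) :
  density_hales_jewett R A -> 0 < dl <= 1 ->
  (forall h, 0 < h -> exists n, line_free_bound (option A) n (dl + h)) ->
  (forall h n, 0 < h -> ~ line_free_bound (option A) n (dl - h)) -> False.
Proof.
move=> dhj /andP[dl0 dl1] upper lower; have c0 : 0 < dl / 4 by lra.
have [m mP] := dhj _ c0.
(* [th] is the density of a popular line, [mu] the density increment to be reached, [h'] the error
   allowed on slices and [h] the error allowed on [S], each chosen small against the previous
   ones. *)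
pose th : R := dl / 4 / #|{ffun 'I_m -> option A}|%:R.
have lines0 : 0 < #|{ffun 'I_m -> option A}|%:R :> R.
  by apply: card_gt0R; exact: [ffun=> None].
have th0 : 0 < th by rewrite divr_gt0.
have th1 : th <= 1 / 4.
  rewrite ler_pdivrMr//; have : 1 <= #|{ffun 'I_m -> option A}|%:R :> R.
    by rewrite ler1n -(ltr0n R).
  by lra.
pose mu : R := dl * th / 8.
have muE : dl * th = 8 * mu by rewrite /mu; lra.
have mu0 : 0 < mu by rewrite divr_gt0// mulr_gt0.
have mu_dl : mu <= dl.
  have : dl * th <= dl * 1 by rewrite ler_pM2l//; lra.
  by rewrite /mu; lra.
have [d dP] := upper _ mu0.
pose nE : R := #|{ffun A -> bool}|%:R.
have nE0 : 0 < nE by apply: card_gt0R; exact: [ffun=> true].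
have eT0 : 0 < dl * th / 16 / nE by rewrite !divr_gt0// mulr_gt0.
have [nT nTP] := insensitive_inter a0 (enum A) d dhj eT0.
have [ng ngP] := few_good_letters (option A) 1 mu0.
pose h' : R := mu * th / 8.
have h'E : mu * th = 8 * h' by rewrite /h'; lra.
have h'0 : 0 < h' by rewrite divr_gt0// mulr_gt0.
have mu_th : mu * th <= mu * (1 / 4) by rewrite ler_pM2l.
have [nh nhP] := upper _ h'0.
have [n2 n2P] := fiber_subsp (A + 'I_m)%type (maxn nT (maxn ng nh)) h'0.
pose h : R := h' / 2 / #|{ffun 'I_n2 -> option A}|%:R.
have words0 : 0 < #|{ffun 'I_n2 -> option A}|%:R :> R.
  by apply: card_gt0R; exact: [ffun=> None].
have h0 : 0 < h by rewrite divr_gt0// divr_gt0.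
have [n nP] := upper _ h0.
apply: (lower h (n2 + n)%N h0) => I nI S Sfree; rewrite leNgt.
apply/negP => dlS.
have [I1 [I2 [e [be c1 c2]]]] := split_card (leq_trans (leq_addr n n2) nI).
have nI2 : (n <= #|I2|)%N by rewrite c2 leq_subRL// (leq_trans (leq_addr n n2)).
have slice_ub t : avg (fun y => (S (merge e t y))%:R) <= dl + h.
  apply: (nP I2 nI2 (fun y => S (merge e t y))) => lS; apply: Sfree.
  apply: (has_line_subsp (nondeg_fix_left t be)).
  move: lS; congr has_line; apply/funext => y /=.
  by rewrite merge_fix_left.
(* No slice exceeds [dl + h] while their mean exceeds [dl - h]; there are few slices compared with
   [h' / h], so none falls below [dl - h']. *)
have slice_lb t : dl - h' <= avg (fun y => (S (merge e t y))%:R).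
  have := avg_deficit t slice_ub; rewrite -(avg_merge (fun x => (S x)%:R) be).
  have : #|{ffun I1 -> option A}|%:R * (dl + h - avg (fun x => (S x)%:R)) <= h'.
    have -> : h' = #|{ffun I1 -> option A}|%:R * (h + h).
      rewrite /h !card_ffun c1 !card_option !card_ord -mulr2n -mulr_natr.
      by field; rewrite pnatr_eq0 -lt0n expn_gt0.
    by rewrite ler_pM2l; [lra|exact: (card_gt0R R [ffun=> None])].
  lra.
(* [p.1] is a random, possibly degenerate, subspace of words over [A], and [p.2] a random suffix;
   [L] is a line inside this subspace. *)
pose Q (p : {ffun I1 -> A + 'I_m} * {ffun I2 -> option A})
    (L : {ffun 'I_m -> option A}) :=
  [exists j, L j == None] &&
  [forall a, S (merge e [ffun i => Some (subsp p.1 (line_at L a) i)] p.2)].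
pose F (p : {ffun I1 -> A + 'I_m} * {ffun I2 -> option A}) : R :=
  avg (fun x => (S (merge e [ffun i => Some (subsp p.1 x i)] p.2))%:R).
have [L] : exists L, th <= avg (fun p => (Q p L)%:R).
  have p0 := ([ffun=> inl a0], [ffun=> None]) :
    {ffun I1 -> A + 'I_m} * {ffun I2 -> option A}.
  apply: (@avg_popular _ _ _ p0 _ (fun p => dl / 4 <= F p)) => //.
    apply: avg_markov => //; first exact: ltW.
      by move=> p; apply: avg_le1 => x; case: (S _).
    rewrite avg_pair.
    rewrite -(avg_cst ([ffun=> inl a0] : {ffun I1 -> A + 'I_m}) (2 * (dl / 4))).
    apply: avg_le => g; rewrite /F avg_exchange/=.
    rewrite -(avg_cst ([ffun=> a0] : {ffun 'I_m -> A}) (2 * (dl / 4))).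
    apply: avg_le => x.
    by apply: le_trans (slice_lb _); rewrite /h'; lra.
  move=> p /mP; rewrite card_ord => /(_ (leqnn _))[L [j Lj] LS].
  exists L; apply/andP; split; last exact/forallP.
  by apply/existsP; exists j; rewrite Lj.
move=> thQ.
(* [pi] turns a uniform word over [A + 'I_m] into a word over [option A] of non-uniform law. This is
   harmless, since [slice_lb] holds for each single prefix. *)
pose pi (l : A + 'I_m) := match l with inl a => Some a | inr j => L j end.
have Lnone : [exists j, L j == None].
  have [|p] := @avg_exists_gt R _ ([ffun=> inl a0], [ffun=> None]) 0
      (fun p => (Q p L)%:R); first exact: lt_le_trans thQ.
  by rewrite /Q; case: [exists j, _]; rewrite ?ltxx.
have /existsP[j0 /eqP Lj0] := Lnone.
have QE g y : Q (g, y) L =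
    [forall a, S (merge e (to_letter a [ffun i => pi (g i)]) y)].
  rewrite /Q Lnone /=; apply: eq_forallb => a; congr (S (merge e _ y)).
  by apply/ffunP => i; rewrite !ffunE; case: (g i) => // j; rewrite ffunE.
(* The weight [mu] of [Q] is small: since line-free sets cannot
   exceed [dl + h'], a fibre with [avg G > 0] is nearly extremal for [S] and
   also gives [Q] density at least [th / 2]. *)
pose G (y : {ffun I2 -> option A}) (g : {ffun I1 -> A + 'I_m}) : R :=
  (S (merge e [ffun i => pi (g i)] y))%:R - (dl + h') +
  mu * ((Q (g, y) L)%:R - th / 2).
have [|y ltG] := @avg_exists_gt R _ [ffun=> None] h' (fun y => avg (G y)).
  rewrite (@eq_avg _ _ _ (fun y => avg (fun g : {ffun I1 -> A + 'I_m} =>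
      (S (merge e [ffun i => pi (g i)] y))%:R) - (dl + h') +
      mu * (avg (fun g => (Q (g, y) L)%:R) - th / 2))); last first.
    move=> y; rewrite /G avgD avgB avgZ avgB.
    by rewrite !(avg_cst ([ffun=> inl a0] : {ffun I1 -> A + 'I_m})).
  rewrite avgD avgB avgZ avgB !(avg_cst ([ffun=> None] : {ffun I2 -> option A})).
  rewrite -[X in mu * (X - _)]avg_exchange -(avg_pair (fun p => (Q p L)%:R)).
  have : mu * th <= mu * avg (fun p => (Q p L)%:R) by rewrite ler_pM2l.
  have : dl - h' <= avg (fun y : {ffun I2 -> option A} =>
      avg (fun g : {ffun I1 -> A + 'I_m} =>
      (S (merge e [ffun i => pi (g i)] y))%:R)).
    rewrite avg_exchange.
    rewrite -(avg_cst ([ffun=> inl a0] : {ffun I1 -> A + 'I_m}) (dl - h')).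
    by apply: avg_le => g.
  set u := avg _ => uE; set v := avg _ => vE; lra.
have nI1 : (n2 <= #|I1|)%N by rewrite c1.
(* [pi] inverts [emb], so resampling the letters in the image of [emb] yields fibres on which the
   words over [option A] are uniform. *)
pose emb (b : option A) : A + 'I_m := if b is Some a then inl a else inr j0.
have embI : injective emb by case=> [a|] [a'|]// [->].
have G1 g : G y g <= 1.
  rewrite /G; case: (S _); case: (Q _ _); rewrite ?mulr0n ?mulr1n; lra.
have [J [W [Wn]]] := n2P I1 nI1 (option A) None emb (G y) embI G1 ltG.
rewrite !geq_max => /and3P[nTJ ngJ nhJ].
pose W' : {ffun I1 -> option A + J} :=
  [ffun i => match W i with inl l => inl (pi l) | inr j => inr j end].
have Wn' : nondeg W'.
  by move=> j; have [i Wi] := Wn j; exists i; rewrite ffunE Wi.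
have W'E (x : {ffun J -> option A}) :
    [ffun i => pi (subsp W [ffun j => emb (x j)] i)] = subsp W' x.
  apply/ffunP => i; rewrite !ffunE; case: (W i) => // j; rewrite ffunE.
  by case: (x j).
pose S' (x : {ffun J -> option A}) := S (merge e (subsp W' x) y).
have S'free (K : finType) (V : {ffun J -> option A + K}) : nondeg V ->
    ~ has_line (S' \o subsp V).
  move=> Vn lS; apply: Sfree.
  apply: (has_line_subsp (nondeg_fix_right y be (nondeg_comp Wn' Vn))).
  move: lS; congr has_line; apply/funext => x /=.
  by rewrite /S' -subsp_comp merge_fix_right.
have S'free1 : ~ has_line S'.
  move=> lS; apply: (S'free J [ffun j => inr j]).
    by move=> j; exists j; rewrite ffunE.
  move: lS; congr has_line; apply/funext => x /=; congr S'.
  by apply/ffunP => j; rewrite !ffunE.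
pose D a (x : {ffun J -> option A}) := S (merge e (to_letter a (subsp W' x)) y).
have Dins a : insensitive a (D a).
  move=> x; rewrite /D; congr (S (merge e _ y)); apply/ffunP => i.
  by rewrite !ffunE; case: (W i) => // j; rewrite ffunE.
pose C x := [forall a, D a x].
under eq_avg => x do rewrite /G QE W'E -/(S' x) -/(C x).
rewrite avgD avgB avgZ avgB !(avg_cst ([ffun=> None] : {ffun J -> option A})).
set s := avg (fun x => (S' x)%:R); set c := avg (fun x => (C x)%:R) => sc.
have s_ub : s <= dl + h' by apply: nhP.
have c_ub : c <= 1 by apply: avg_le1 => x; case: (C x).
have c_lb : th / 2 <= c.
  by rewrite -(ler_pM2l mu0); lra.
have s_lb : dl - mu <= s.
  have : mu * c <= mu * 1 by rewrite ler_pM2l.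
  lra.
(* A word with some letter [None] lying in both [S'] and [C] gives a line of [S]; by the choice of
   [ng], words without [None] have density at most [mu]. *)
have SC : avg (fun x => (S' x && C x)%:R) <= mu.
  apply: le_trans (ngP J ngJ [pred l | l == None] None (eqxx _)).
  apply: avg_le => x; rewrite ltnS leqn0.
  case: eqP => [_|/eqP]; first by case: (_ && _).
  rewrite -lt0n => /card_gt0P[j]; rewrite !inE => /eqP xj.
  case: (boolP (S' x && C x)) => // /andP[Sx /forallP Cx]; exfalso.
  apply: Sfree; have [i Wi] := Wn' j; case: (be) => f ef fe.
  exists [ffun i => match e i with
    | inl i1 => if subsp W' x i1 is Some b then Some (Some b) else None
    | inr i2 => Some (y i2) end].
    by exists (f (inl i)); rewrite ffunE fe ffunE Wi xj.
  case=> [a|]; [move: (Cx a)|move: Sx]; congr (is_true (S _)).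
    apply/ffunP => k; rewrite !ffunE; case: (e k) => // k1; rewrite ffunE.
    by case: (subsp W' x k1).
  apply/ffunP => k; rewrite !ffunE; case: (e k) => // k1.
  by case: (subsp W' x k1).
pose f x : R := (S' x)%:R - (dl + mu).
have f1 x : f x <= 1 by rewrite /f; case: (S' x); rewrite ?mulr1n ?mulr0n; lra.
(* Removing [C] discards density at least [th / 2] but at most [mu] of [S'], and [mu] is small
   against [dl * th]. *)
have f_nC : dl * th / 8 <= avg (fun x => f x * (~~ C x)%:R).
  rewrite (@eq_avg _ _ _ (fun x => (S' x)%:R - (S' x && C x)%:R -
      (dl + mu) * (1 - (C x)%:R))); last first.
    by move=> x; rewrite /f; case: (S' x); case: (C x);
      rewrite /= ?mulr0n ?mulr1n; ring.
  rewrite !avgB avgZ avgB (avg_cst ([ffun=> None] : {ffun J -> option A})) -/s -/c.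
  have : (dl + mu) * (1 - c) <= (dl + mu) * (1 - th / 2).
    by rewrite ler_pM2l; lra.
  lra.
(* The atoms of the boolean algebra generated by the sets [D a]. *)
pose DE (E : {ffun A -> bool}) a x := D a x == E a.
have nCE x : (~~ C x)%:R = \sum_(E : {ffun A -> bool}) (~~ [forall a, E a])%:R *
    (all (DE E ^~ x) (enum A))%:R :> R.
  rewrite (bigD1 [ffun a => D a x])//= big1 ?addr0; last first.
    move=> E nE'; rewrite (_ : all _ _ = false) ?mulr0//.
    apply/negbTE; apply: contra nE' => /allP DEx; apply/eqP/ffunP => a.
    by rewrite ffunE; apply/esym/eqP/DEx; rewrite mem_enum.
  rewrite (_ : all _ _ = true) ?mulr1; last first.
    by apply/allP => a _; rewrite /DE ffunE.
  by congr (~~ _)%:R; apply: eq_forallb => a; rewrite ffunE.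
have [E ltE] : exists E, dl * th / 16 / nE <
    avg (fun x => f x * (all (DE E ^~ x) (enum A))%:R).
  apply/not_existsP => leE; suff : dl * th / 8 <= dl * th / 16.
    by have := mulr_gt0 dl0 th0; lra.
  apply: (le_trans f_nC).
  under eq_avg => x do rewrite nCE mulr_sumr.
  rewrite avg_sum.
  apply: (@le_trans _ _ (\sum_(E : {ffun A -> bool}) dl * th / 16 / nE)).
    apply: ler_sum => E _; under eq_avg => x do rewrite mulrCA.
    rewrite avgZ; case: (~~ _); rewrite ?mul0r ?mul1r; last exact: ltW.
    by rewrite leNgt; apply/negP/leE.
  by rewrite sumr_const -[X in X <= _]mulr_natr -/nE divfK// gt_eqF.
have DEins a : insensitive a (DE E a) by move=> x; rewrite /DE Dins.
have [V Vn] := nTP J nTJ (DE E) f DEins f1 ltE.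
rewrite /f avgB (avg_cst ([ffun=> None] : {ffun 'I_d -> option A})) subr_gt0 ltNge.
by apply/negP/negPn/dP; [rewrite card_ord|apply: S'free].
Qed.

(** The infimum of the density bounds valid for line-free sets in all high dimensions is the
    limiting density. If it is at most [0] the claim follows; otherwise [limit_density_absurd]
    applies. *)
Lemma density_hales_jewett_option (R : realType) (A : finType) (a0 : A) :
  density_hales_jewett R A -> density_hales_jewett R (option A).
Proof.
move=> dhj; pose E := [set c : R | exists n, line_free_bound (option A) n c].
have E1 : E 1.
  by exists 0%N => I _ S _; apply: avg_le1 => x; case: (S x).
have E0 : lbound E 0.
  move=> c [n /(_ 'I_n)]; rewrite card_ord => /(_ (leqnn n) (fun=> false)) nc.
  rewrite -(avg_cst ([ffun=> None] : {ffun 'I_n -> option A}) (0 : R)) nc//.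
  by case=> L _ /(_ None).
have Einf : has_inf E by split; [exists 1|exists 0].
case: (ltP 0 (inf E)) => [dl0|dl0]; last first.
  move=> c c0; have [c' [n nP] c'c] := inf_adherent c0 Einf.
  exists n => I /nP IP S cS; apply: contrapT => /IP.
  by apply/negP; rewrite -ltNge; lra.
exfalso; apply: (limit_density_absurd a0 dhj (dl := inf E)).
- by rewrite dl0/=; apply: ge_inf => //; exists 0.
- move=> h /inf_adherent/(_ Einf)[c [n nP] cE]; exists n => I /nP IP S /IP.
  by move=> /le_trans; apply; apply: ltW.
- move=> h n h0 Eh; have : inf E <= inf E - h.
    by apply: ge_inf; [exists 0|exists n].
  lra.
Qed.

(** Over one letter the only word is a line by itself, with all coordinates moving; [1] ensures that
    there is a coordinate. *)
Lemma density_hales_jewett_unit (R : realType) : density_hales_jewett R unit.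
Proof.
move=> c c0; exists 1%N => I I1 S cS.
have [|x] := @avg_exists_gt R _ [ffun=> tt] 0 (fun x => (S x)%:R).
  exact: lt_le_trans cS.
case Sx : (S x); rewrite ?ltxx// => _; exists [ffun=> None].
  by have /card_gt0P[i _] := I1; exists i; rewrite ffunE.
case; rewrite (_ : line_at _ _ = x)//.
by apply/ffunP => i; case: (x i); rewrite !ffunE.
Qed.

Lemma density_hales_jewett_nat (R : realType) (k : nat) :
  exists (A : finType) (v : A -> nat),
    (forall j, (j <= k)%N -> exists a, v a = j) /\ density_hales_jewett R A.
Proof.
suff : exists (A : finType) (v : A -> nat) (a0 : A),
    (forall j, (j <= k)%N -> exists a, v a = j) /\ density_hales_jewett R A.
  by move=> [A [v [_ ?]]]; exists A, v.
elim: k => [|k [A [v [a0 [vP dhj]]]]].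
  exists unit, (fun=> 0%N), tt; split; last exact: density_hales_jewett_unit.
  by move=> j; rewrite leqn0 => /eqP ->; exists tt.
exists (option A), (fun o => if o is Some a then v a else k.+1), None; split.
  move=> j; rewrite leq_eqVlt => /predU1P[->|]; first by exists None.
  by rewrite ltnS => /vP[a <-]; exists (Some a).
exact: density_hales_jewett_option.
Qed.

(** * Recurrence of sets *)

Lemma integrable_sum_indic (d : measure_display) (X : measurableType d)
    (R : realType) (mu : probability X R) (I : finType) (S : I -> set X) :
  (forall i, measurable (S i)) ->
  mu.-integrable setT (EFin \o (fun x => \sum_i \1_(S i) x)).
Proof.
move=> mS; rewrite (_ : EFin \o _ = fun x => (\sum_i (\1_(S i) x)%:E)%E); last first.
  by apply/funext => x /=; rewrite sumEFin.
apply: integrable_sum => // i _; apply: integrable_indic => //.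
Qed.

Lemma Rintegral_sum_indic (d : measure_display) (X : measurableType d)
    (R : realType) (mu : probability X R) (I : finType) (S : I -> set X) :
  (forall i, measurable (S i)) ->
  \int[mu]_x (\sum_i \1_(S i) x) = \sum_i fine (mu (S i)).
Proof.
move=> mS; rewrite /Rintegral; under eq_integral do rewrite -sumEFin.
rewrite ge0_integral_sum//; last first.
  by move=> i; apply/measurable_EFinP; apply: measurable_indic.
rewrite -sum_fine => [|i _]; last first.
  by rewrite integral_indic// setIT fin_num_measure.
by apply: eq_bigr => i _; rewrite integral_indic// setIT.
Qed.

(** Pointwise, the average of the indicators of the [S i] is at most [b / 2] plus the sum of those
    of the [Q l]. Integration leaves at least [b / 2] for the measures of the [Q l]. *)
Lemma probability_pigeonhole (d : measure_display) (X : measurableType d)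
    (R : realType) (mu : probability X R) (I L : finType) (i0 : I) (b : R)
    (S : I -> set X) (Q : L -> set X) :
  0 < b -> (forall i, measurable (S i)) -> (forall l, measurable (Q l)) ->
  (forall i, fine (mu (S i)) = b) ->
  (forall x, b / 2 <= avg (fun i => (x \in S i)%:R) -> exists l, Q l x) ->
  exists l, b / 2 / #|L|%:R <= fine (mu (Q l)).
Proof.
move=> b0 mS mQ Sb SQ; have I0 := card_gt0R R i0.
have iQ := integrable_sum_indic mu mQ.
have ic (r : R) : mu.-integrable setT (EFin \o (cst r : X -> R)).
  by apply/finite_measure_integrable_cst.
have cE (r : R) : \int[mu]_x (cst r x) = r.
  have muT : fine (mu setT) = 1 := congr1 fine (probability_setT mu).
  by rewrite Rintegral_cst// -[RHS]mulr1 -muT.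
have iIQ : mu.-integrable setT (EFin \o (fun x => #|I|%:R * \sum_l \1_(Q l) x)).
  exact: (integrableZl measurableT #|I|%:R iQ).
have : \int[mu]_x (\sum_i \1_(S i) x) <=
    \int[mu]_x (#|I|%:R * (b / 2) + #|I|%:R * \sum_l \1_(Q l) x).
  apply: le_Rintegral => //; first exact: integrable_sum_indic.
    exact: integrableD (ic _) iIQ.
  move=> x _; rewrite -mulrDr mulrC -ler_pdivrMr//.
  have [/SQ[l Ql]|] := leP (b / 2) (avg (fun i => (x \in S i)%:R)).
    apply: (@le_trans _ _ 1); last first.
      rewrite (bigD1 l)//= indicE mem_set//.
      by rewrite addrA addrAC lerDr addr_ge0 ?sumr_ge0 ?divr_ge0// ltW.
    by apply: avg_le1 => i; rewrite indicE lern1 leq_b1.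
  by move/ltW => /le_trans; apply; rewrite lerDl sumr_ge0.
rewrite (RintegralD measurableT (ic (#|I|%:R * (b / 2))) iIQ) cE.
rewrite (RintegralZl #|I|%:R measurableT iQ).
rewrite !Rintegral_sum_indic//.
have -> : \sum_i fine (mu (S i)) = #|I|%:R * b.
  by rewrite (eq_bigr (fun=> b))// sumr_const mulr_natl.
rewrite -mulrDr ler_pM2l// {1}[b]splitr lerD2l => bQ; apply/not_existsP => nL.
move: bQ; apply/negP; rewrite -ltNge; case: (pickP (@predT L)) => [l0 _|L0].
  apply: (@lt_le_trans _ _ (\sum_(l : L) b / 2 / #|L|%:R)).
    apply: ltr_sum; last by move=> l _; rewrite ltNge; apply/negP/nL.
    by apply/hasP; exists l0 => //; rewrite mem_index_enum.
  by rewrite sumr_const -[X in X <= _]mulr_natr divfK// gt_eqF// (card_gt0R R l0).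
by rewrite big_pred0// divr_gt0.
Qed.

Lemma measurable_iter (d : measure_display) (X : measurableType d)
    (phi : X -> X) (n : nat) :
  measurable_fun setT phi -> measurable_fun setT (iter n phi).
Proof.
move=> mphi; elim: n => [|n IHn]; first exact: measurable_id.
exact: measurableT_comp mphi IHn.
Qed.

Lemma measurable_preimage_iter (d : measure_display) (X : measurableType d)
    (phi : X -> X) (n : nat) (A : set X) :
  measurable_fun setT phi -> measurable A ->
  measurable [set x | A (iter n phi x)].
Proof.
move=> mphi mA; rewrite -[X in measurable X]setTI.
exact: measurable_iter mphi measurableT _ mA.
Qed.

Lemma measure_preimage_iter (d : measure_display) (X : measurableType d)
    (R : realType) (mu : probability X R) (phi : X -> X) (n : nat) (A : set X) :
  measure_preserving_system mu phi -> measurable A ->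
  mu [set x | A (iter n phi x)] = mu A.
Proof.
case=> mphi _ muphi; elim: n A => [|n IHn] A mA; first exact: congr1.
have -> : [set x | A (iter n.+1 phi x)] = [set x | (phi @^-1` A) (iter n phi x)].
  by [].
by rewrite IHn ?muphi// -[X in measurable X]setTI; apply: mphi.
Qed.

Definition multiple_return (X : Type) (phi : X -> X) (k : nat) (B : set X)
    (r : nat) : set X :=
  [set x | forall i, (i <= k)%N -> B (iter (i * r) phi x)].

Lemma measurable_multiple_return (d : measure_display) (X : measurableType d)
    (phi : X -> X) (k : nat) (B : set X) (r : nat) :
  measurable_fun setT phi -> measurable B ->
  measurable (multiple_return phi k B r).
Proof.
move=> mphi mB; rewrite (_ : multiple_return _ _ _ _ =
    \bigcap_(i in [set i | (i <= k)%N]) [set x | B (iter (i * r) phi x)]).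
  by apply: bigcap_measurableType => i _; apply: measurable_preimage_iter.
by apply/seteqP; split=> x Tx i ik; exact: (Tx i ik).
Qed.

(* Letting a word [w] act as the power [e * \sum_p v (w p)] of [phi], a
   combinatorial line of words becomes a progression whose step is [e] times
   the number of moving coordinates of the line. *)
Lemma set_recurrence (d : measure_display) (X : measurableType d)
    (R : realType) (mu : probability X R) (phi : X -> X) (k : nat) (B : set X) :
  measure_preserving_system mu phi -> measurable B -> 0 < fine (mu B) ->
  exists (n : nat) (th : R), 0 < th /\
    forall e, exists2 j, (0 < j <= n)%N &
      th <= fine (mu (multiple_return phi k B (j * e))).
Proof.
move=> mps mB b0; have [mphi _ _] := mps.
have [A [v [vP dhj]]] := density_hales_jewett_nat R k.
have [a0 _] := vP _ (leq0n k).
have [n /(_ 'I_n)] := dhj _ (divr_gt0 b0 (ltr0n R 2)).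
rewrite card_ord => /(_ (leqnn n)) nP.
have L0 : 0 < #|{ffun 'I_n -> option A}|%:R :> R.
  by apply: card_gt0R; exact: [ffun=> None].
exists n, (fine (mu B) / 2 / #|{ffun 'I_n -> option A}|%:R).
split; first by rewrite divr_gt0// divr_gt0.
move=> e; pose S (w : {ffun 'I_n -> A}) :=
  [set x | B (iter (e * \sum_p v (w p)) phi x)].
(* The moving coordinate required here makes [j] positive once [Q l] has positive measure. *)
pose Q (l : {ffun 'I_n -> option A}) :=
  [set x | (exists p, l p = None) /\ forall a, S (line_at l a) x].
have mS w : measurable (S w) by apply: measurable_preimage_iter.
have mQ l : measurable (Q l).
  have [pl|npl] := pselect (exists p, l p = None); last first.
    by rewrite (_ : Q l = set0)//; apply/seteqP; split=> x // [].
  rewrite (_ : Q l = \bigcap_(a in [set: A]) S (line_at l a)).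
    by apply: fin_bigcap_measurable => //; exact: finite_finset.
  by apply/seteqP; split=> [x [_ Sx] a _|x Sx]; [|split => // a]; apply: Sx.
have [||l] :=
  probability_pigeonhole (mu := mu) ([ffun=> a0] : {ffun 'I_n -> A}) b0 mS mQ.
- by move=> w; rewrite /S measure_preimage_iter.
- by move=> x /nP[l lp lS]; exists l; split => // a; have := lS a; rewrite inE.
move=> muQ; pose j := #|[pred p | l p == None]|.
have [p lp] : exists p, l p = None.
  apply/not_existsP => nl; move: muQ.
  rewrite (_ : Q l = set0) ?measure0 ?fine0; last first.
    by apply/seteqP; split=> x // [[p lp]]; case: (nl p).
  by apply/negP; rewrite -ltNge divr_gt0// divr_gt0.
exists j.
  apply/andP; split; first by apply/card_gt0P; exists p; rewrite inE lp.
  by rewrite -[leqRHS]card_ord max_card.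
apply: (le_trans muQ).
have mT := measurable_multiple_return k (j * e) mphi mB.
pose s0 := (\sum_p if l p is Some a then v a else 0)%N.
rewrite -(measure_preimage_iter (e * s0) mps mT).
rewrite fine_le ?fin_num_measure ?le_measure ?inE//.
all: try exact: measurable_preimage_iter.
move=> x [_ Sx] i ik /=; have [a <-] := vP i ik.
have := Sx a; rewrite /S /= -iterD; congr (B (iter _ phi x)).
have -> : (\sum_p v (line_at l a p) = s0 + v a * j)%N.
  rewrite /s0 /j mulnC -sum_nat_const [X in (_ + X)%N]big_mkcond -big_split.
  by apply: eq_bigr => q _ /=; rewrite ffunE inE; case: (l q) => //= b; rewrite addn0.
by rewrite mulnDr addnC mulnCA [(e * j)%N]mulnC.
Qed.

(** * Averages of multiple integrals *)

Lemma ler_sum_dilate (R : realType) (a : nat -> R) (j m : nat) :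
  (forall r, 0 <= a r) -> (0 < j)%N ->
  \sum_(1 <= e < m.+1) a (j * e)%N <= \sum_(1 <= r < (j * m).+1) a r.
Proof.
move=> a0 j0; elim: m => [|m IHm]; first by rewrite muln0 !big_geq.
rewrite big_nat_recr//= [leRHS](big_cat_nat (n := (j * m).+1))//=; last first.
  by rewrite ltnS leq_mul2l leqnSn orbT.
rewrite lerD// mulnS big_nat_recr//=; last by rewrite -add1n leq_add2r.
by rewrite lerDr sumr_ge0.
Qed.

(** Summing the lower bounds over [e <= m = N %/ n] gives [m * th], at most the sum over [j <= n] of
    the dilated sums, each at most the full sum as [j * m <= N]. With [N <= 2 * m * n] the averages
    are at least [rho] once [N >= n]. *)
Lemma limn_einf_average_gt0 (R : realType) (a : nat -> R) (n : nat) (th : R) :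
  0 < th -> (forall r, 0 <= a r) ->
  (forall e, exists2 j, (0 < j <= n)%N & th <= a (j * e)%N) ->
  (0 < limn_einf (fun N : nat => (N%:R^-1 * \sum_(1 <= r < N.+1) a r)%:E))%E.
Proof.
move=> th0 a0 aP; have n0 : (0 < n)%N.
  by have [j /andP[j0 jn] _] := aP 0%N; apply: leq_trans jn.
have nR : 0 < n%:R :> R by rewrite ltr0n.
pose rho : R := th / (2 * n%:R * n%:R).
have rho0 : 0 < rho by rewrite divr_gt0// !mulr_gt0.
have avg_rho N : (n <= N)%N ->
    rho <= N%:R^-1 * \sum_(1 <= r < N.+1) a r.
  move=> nN; have N0 : 0 < N%:R :> R by rewrite ltr0n (leq_trans n0).
  pose m := (N %/ n)%N; have m0 : (0 < m)%N by rewrite divn_gt0.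
  have Nm : N%:R <= 2 * m%:R * n%:R :> R.
    rewrite -!natrM ler_nat (leq_trans (ltnW (ltn_ceil N n0)))// leq_mul2r.
    by rewrite mul2n -addnn -addn1 leq_add2l m0 orbT.
  have le_th : m%:R * th <= n%:R * \sum_(1 <= r < N.+1) a r.
    apply: (@le_trans _ _
        (\sum_(1 <= e < m.+1) \sum_(1 <= j < n.+1) a (j * e)%N)).
      rewrite (_ : m%:R * th = \sum_(1 <= e < m.+1) th); last first.
        by rewrite sumr_const_nat subn1 mulr_natl.
      apply: ler_sum => e _; have [j /andP[j0 jn]] := aP e.
      move=> /le_trans; apply.
      rewrite (bigD1_seq j)/= ?iota_uniq ?mem_index_iota ?j0//.
      by rewrite lerDl sumr_ge0.
    rewrite exchange_big/= (_ : n%:R * _ = \sum_(1 <= j < n.+1)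
      \sum_(1 <= r < N.+1) a r); last by rewrite sumr_const_nat subn1 mulr_natl.
    rewrite big_nat [leRHS]big_nat; apply: ler_sum => j /andP[j0 jn].
    rewrite (le_trans (ler_sum_dilate m a0 j0))//.
    have jmN : (j * m <= N)%N.
      by rewrite (leq_trans _ (leq_divM N n))// mulnC leq_mul2l -ltnS jn orbT.
    rewrite [leRHS](big_cat_nat (n := (j * m).+1))//= lerDl.
    by rewrite sumr_ge0.
  rewrite mulrC ler_pdivlMr// -(ler_pM2l nR) (le_trans _ le_th)//.
  have -> : n%:R * (rho * N%:R) = N%:R / (2 * n%:R) * th.
    by rewrite /rho; field; rewrite gt_eqF.
  by rewrite ler_pM2r// ler_pdivrMr ?mulr_gt0// mulrA [m%:R * 2]mulrC.
rewrite limn_einf_lim; apply: (@lt_le_trans _ _ rho%:E); first by rewrite lte_fin.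
apply: lime_ge; first exact: is_cvg_einfs.
exists n => // m /= nm; apply: le_ereal_inf_tmp => _ [N /= mN <-].
by rewrite lee_fin avg_rho// (leq_trans nm).
Qed.

Lemma ae_iter (d : measure_display) (X : measurableType d) (R : realType)
    (mu : probability X R) (phi : X -> X) (P : X -> Prop) (n : nat) :
  measure_preserving_system mu phi -> {ae mu, forall x, P x} ->
  {ae mu, forall x, P (iter n phi x)}.
Proof.
move=> mps [N [mN muN PN]]; have [mphi _ _] := mps.
exists [set x | N (iter n phi x)]; split.
- exact: measurable_preimage_iter.
- by rewrite measure_preimage_iter.
- by move=> x /= nP; apply: PN.
Qed.

Lemma iter_koopman (X R : Type) (phi : X -> X) (f : X -> R) (n : nat) (x : X) :
  iter n (koopman phi) f x = f (iter n phi x).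
Proof. by elim: n x => // n IHn x; rewrite iterS /koopman /= IHn -iterSr. Qed.

Lemma Lfun_infty_bounded (d : measure_display) (X : measurableType d)
    (R : realType) (mu : probability X R) (f : X -> R) :
  f \in Lfun mu +oo%E ->
  measurable_fun setT f /\ exists C : R, {ae mu, forall x, `|f x| <= C}.
Proof.
case/andP => /[!inE] mf; rewrite /finite_norm unlock.
have mu0 : (0 < mu setT)%E by rewrite probability_setT lte01.
rewrite /=; case: ifP => [_ fy|/negP/(_ mu0)//]; split => //.
exact: (ess_supr_bounded (f := Num.norm \o f)).
Qed.

(** Truncation at [0] and at an essential bound changes [f] on a null set only, and makes the bounds
    hold everywhere. *)
Lemma ae_nonneg_bounded_trunc (d : measure_display) (X : measurableType d)
    (R : realType) (mu : probability X R) (f : X -> R) :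
  f \in Lfun mu +oo%E -> {ae mu, forall x, 0 <= f x} ->
  exists (g : X -> R) (C : R),
    [/\ measurable_fun setT g, forall x, 0 <= g x <= C &
        {ae mu, forall x, f x = g x}].
Proof.
move=> /Lfun_infty_bounded[mf [C fC]] f0; pose D := Num.max 0 C.
exists (fun x => Num.max 0 (Num.min (f x) D)), D; split.
- apply: (measurable_maxr (f := cst 0)) => //.
  by apply: (measurable_minr (g := cst D)).
- by move=> x; rewrite le_max lexx/= ge_max ge_min lexx orbT andbT le_max lexx.
- apply: filterS2 f0 fC => x f0 fC.
  have fD : f x <= D by rewrite le_max (le_trans (ler_norm _) fC) orbT.
  by rewrite (min_idPl fD) (max_idPr f0).
Qed.

Lemma measurable_superlevel (d : measure_display) (X : measurableType d)
    (R : realType) (g : X -> R) (e : R) :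
  measurable_fun setT g -> measurable [set x | e <= g x].
Proof.
move=> mg; rewrite (_ : [set x | _] = setT `&` g @^-1` `[e, +oo[).
  exact: mg.
by apply/seteqP; split=> x /=; rewrite in_itv/= andbT; [split|case].
Qed.

(** The set where [g] is positive is the countable union of the sets [n.+1%:R^-1 <= g], which cannot
    all be null. *)
Lemma nonneg_superlevel_gt0 (d : measure_display) (X : measurableType d)
    (R : realType) (mu : probability X R) (g : X -> R) :
  measurable_fun setT g -> (forall x, 0 <= g x) ->
  ~ {ae mu, forall x, g x = 0} ->
  exists2 e : R, 0 < e & 0 < fine (mu [set x | e <= g x]).
Proof.
move=> mg g0 gn0; apply: contrapT => nE; apply: gn0.
have mB e := measurable_superlevel e mg.
have : {ae mu, forall x, forall n, ~ (n.+1%:R^-1 <= g x)}.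
  apply: ae_foralln => n; exists [set x | n.+1%:R^-1 <= g x]; split => //.
    apply/eqP; rewrite -measure_le0 leNgt; apply/negP => mu0; apply: nE.
    exists n.+1%:R^-1; rewrite ?invr_gt0// fine_gt0// mu0/=.
    by rewrite (le_lt_trans (probability_le1 mu (mB _)))// ltry.
  by move=> x /= /contrapT.
apply: filterS => x gx; apply/eqP; rewrite eq_le g0 andbT leNgt; apply/negP => gx0.
apply: (gx (Num.truncn (g x)^-1)).
by rewrite -[leRHS]invrK lef_pV2 ?posrE ?invr_gt0// ltW// truncnS_gt.
Qed.

(** On the set of multiple returns each of the [k.+1] factors is at least [e]; elsewhere the product
    is nonnegative. *)
Lemma Rintegral_multiple_ge (d : measure_display) (X : measurableType d)
    (R : realType) (mu : probability X R) (phi : X -> X) (g : X -> R) (C e : R)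
    (k r : nat) :
  measurable_fun setT phi -> measurable_fun setT g ->
  (forall x, 0 <= g x <= C) -> 0 < e ->
  e ^+ k.+1 * fine (mu (multiple_return phi k [set x | e <= g x] r)) <=
  \int[mu]_x \prod_(0 <= j < k.+1) g (iter (j * r) phi x).
Proof.
move=> mphi mg gC e0; set T := multiple_return _ _ _ _.
have mT : measurable T.
  by apply: measurable_multiple_return; last exact: measurable_superlevel.
have muT : \int[mu]_x \1_T x = fine (mu T).
  by rewrite /Rintegral integral_indic// setIT.
have iT : mu.-integrable setT (EFin \o \1_T) by exact: integrable_indic.
rewrite -muT -RintegralZl//; apply: le_Rintegral => //.
- exact: (integrableZl measurableT (e ^+ k.+1) iT).
- apply: measurable_bounded_integrable => //.
  + by rewrite (le_lt_trans (probability_le1 mu measurableT))// ltry.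
  + apply: measurable_prod => j _; apply: measurableT_comp => //.
    exact: measurable_iter.
  + exists (C ^+ k.+1); split; first exact: num_real.
    move=> M CM x _ /=; rewrite (le_trans _ (ltW CM))// ger0_norm; last first.
      by apply: prodr_ge0 => j _; case/andP: (gC (iter (j * r) phi x)).
    rewrite -[k.+1 in leRHS]subn0 -prodr_const_nat.
    by apply: ler_prod => j _; exact: gC.
- move=> x _; rewrite indicE; case: (boolP (x \in T)) => [|_]; last first.
    rewrite mulr0; apply: prodr_ge0 => j _.
    by case/andP: (gC (iter (j * r) phi x)).
  rewrite inE mulr1 => Tx; rewrite -[k.+1 in leLHS]subn0 -prodr_const_nat.
  rewrite big_nat [leRHS]big_nat; apply: ler_prod => j /andP[_ jk].
  by rewrite (ltW e0)/=; apply: Tx.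
Qed.

Theorem theorem2p3 (d : measure_display) (X : measurableType d)
    (R : realType) (mu : probability X R) (phi : X -> X)
    (mps : measure_preserving_system mu phi) (erg : ergodic mu phi) :
  forall (k : nat) (f : X -> R),
    f \in Lfun mu +oo%E -> ae_positive mu f ->
    (0 < limn_einf (fun N : nat =>
       (N%:R^-1 * \sum_(1 <= n < N.+1)
          \int[mu]_x \prod_(0 <= j < k.+1)
             iter (j * n) (koopman phi) f x)%:E))%E.
Proof.
move=> k f fL [f_ge0 fn0]; have [mphi _ _] := mps.
have [mf _] := Lfun_infty_bounded fL.
have [g [C [mg gC fg]]] := ae_nonneg_bounded_trunc fL f_ge0.
have g0 x : 0 <= g x by case/andP: (gC x).
have gn0 : ~ {ae mu, forall x, g x = 0}.
  by move=> gz; apply: fn0; apply: filterS2 fg gz => x ->.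
have [e e0 muB] := nonneg_superlevel_gt0 mg g0 gn0.
have mB := measurable_superlevel e mg.
have [n [th [th0 nP]]] := set_recurrence k mps mB muB.
pose a r := \int[mu]_x \prod_(0 <= j < k.+1) g (iter (j * r) phi x).
have aE r : \int[mu]_x \prod_(0 <= j < k.+1) iter (j * r) (koopman phi) f x = a r.
  have mprod (h : X -> R) : measurable_fun setT h ->
      measurable_fun setT
        (fun x => (\prod_(0 <= j < k.+1) h (iter (j * r) phi x))%:E).
    move=> mh; apply/measurable_EFinP; apply: measurable_prod => j _.
    by apply: measurableT_comp => //; apply: measurable_iter.
  congr fine; under eq_integral => x _ do
    under eq_bigr => j _ do rewrite iter_koopman.
  apply: ae_eq_integral => //; [exact: mprod|exact: mprod|].
  (* Invariance of [mu] and countability give one null set off which [f] and [g] agree at all the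
     iterates. *)
  have := ae_foralln (fun j => ae_iter (j * r) mps fg).
  by apply: filterS => x fgx _; congr (_%:E); apply: eq_bigr => j _.
under [X in limn_einf X]eq_fun => N do under eq_bigr => r _ do rewrite aE.
apply: (@limn_einf_average_gt0 _ a n (e ^+ k.+1 * th)).
- by rewrite mulr_gt0// exprn_gt0.
- by move=> r; apply: Rintegral_ge0 => x _; apply: prodr_ge0 => j _.
- move=> s; have [j jn thj] := nP s; exists j => //.
  apply: le_trans (Rintegral_multiple_ge mu k (j * s) mphi mg gC e0).
  by rewrite ler_pM2l// exprn_gt0.
Qed.
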